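(* Let $(X,\mathbb{R}_+)$ be a connected, finite-dimensional, locally finite, relative cell complex in the usual topological sense, with at most a countable number of cells in each dimension. Then, endowed with the cocompact externology, $X\in\mathbf{C}_*$, i.e. $X$ is a cofibrant object of $\mathbf{E}_*$.
   Context: Spaces are compactly generated weakly Hausdorff. An exterior space is a space $X$ with a nonempty family of open subsets (exterior sets) closed under finite intersections and under passing to larger open sets; a continuous map is exterior if preimages of exterior sets are exterior; $\mathbf{E}$ is the resulting category. The cocompact externology on a space consists of the complements of its closed compact subsets; $\mathbb{R}_+=[0,\infty)$ and $\mathbb{N}$ carry it. $X\bar\times Y$ ($X$ exterior, $Y$ a space) is $X\times Y$ with exterior sets those open $W$ such that for each $y\in Y$ there are an exterior $F\subset X$ and an open neighbourhood $U$ of $y$ with $F\times U\subset W$. The exterior model structure on $\mathbf{E}$ is cofibrantly generated with generating cofibrations $\{\mathbb{N}\bar\times S^{n-1}\to\mathbb{N}\bar\times D^n\}_{n\ge0}$ (with $S^{-1}=\varnothing$) and generating trivial cofibrations $\{\mathbb{N}\bar\times D^n\to\mathbb{N}\bar\times(D^n\times I)\}_{n\ge0}$; its cofibrations are the retracts of relative cell complexes built from the generating cofibrations. $\mathbf{E}_*$ is the category of diagrams $\mathbb{R}_+\xrightarrow{s}X\xrightarrow{r}\mathbb{R}_+$ in $\mathbf{E}$ with $rs=\mathrm{id}$, with morphisms commuting with $s$ and $r$; fibrations, cofibrations and weak equivalences are those of underlying maps in $\mathbf{E}$. An object is cofibrant in $\mathbf{E}_*$ iff its section $s$ is a cofibration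 in $\mathbf{E}$. $\mathbf{C}_*$ is the full subcategory of cofibrant objects of $\mathbf{E}_*$. Here the section of $X$ is the inclusion $\mathbb{R}_+\hookrightarrow X$, and the assertion $X\in\mathbf{C}_*$ includes the existence of an exterior (i.e. proper) retraction $X\to\mathbb{R}_+$ of it. *)

(* Defs.v *)
From HB Require Import structures.
From mathcomp Require Import all_boot all_order all_algebra.
From mathcomp Require Import all_classical all_reals topology normedtype.

Set Implicit Arguments.
Unset Strict Implicit.
Unset Printing Implicit Defensive.

Import Order.TTheory GRing.Theory Num.Theory numFieldNormedType.Exports.
Local Open Scope classical_set_scope.
Local Open Scope ring_scope.

(* A minimal interface, sufficient to state universal properties once for both
   topological and exterior spaces: categories whose objects have an underlying
   type and whose morphisms are functions (the identity and composition laws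
   play no role below). *)
Record concreteCat := ConcreteCat {
  ob : Type;
  el :> ob -> Type;
  hom : forall A B : ob, (el A -> el B) -> Prop }.

Arguments hom : clear implicits.

Definition is_pushout (K : concreteCat) (A B C D : ob K)
    (i : K A -> K B) (f : K A -> K C) (g : K B -> K D) (j : K C -> K D) : Prop :=
  [/\ hom K _ _ i, hom K _ _ f, hom K _ _ g & hom K _ _ j] /\
  g \o i = j \o f /\
  forall (T : ob K) (u : K B -> K T) (v : K C -> K T),
    hom K _ _ u -> hom K _ _ v -> u \o i = v \o f ->
    exists! w : K D -> K T, [/\ hom K _ _ w, w \o g = u & w \o j = v].

Definition is_retract (K : concreteCat) (A B C D : ob K)
    (f : K A -> K B) (g : K C -> K D) : Prop :=
  exists (i : K A -> K C) (r : K C -> K A) (i' : K B -> K D) (r' : K D -> K B),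
  [/\ hom K _ _ i, hom K _ _ r, hom K _ _ i' & hom K _ _ r'] /\
  [/\ r \o i = id, r' \o i' = id, g \o i = i' \o f & f \o r = r' \o g].

Definition Top : concreteCat :=
  @ConcreteCat topologicalType (fun X => X) (fun X Y f => continuous f).

Definition weakly_hausdorff (X : topologicalType) : Prop :=
  forall (K : topologicalType) (f : K -> X),
    compact [set: K] -> hausdorff_space K -> continuous f -> closed (range f).

Definition compactly_generated (X : topologicalType) : Prop :=
  forall A : set X,
    (forall (K : topologicalType) (f : K -> X),
      compact [set: K] -> hausdorff_space K -> continuous f ->
      closed (f @^-1` A)) ->
    closed A.

Definition cgwh (X : topologicalType) : Prop :=
  compactly_generated X /\ weakly_hausdorff X.

Record extSpace := ExtSpace {
  space :> topologicalType;
  space_cgwh : cgwh space;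
  exterior : set (set space);
  exterior_nonempty : exterior !=set0;
  exterior_open : forall F, exterior F -> open F;
  exteriorI : forall F G, exterior F -> exterior G -> exterior (F `&` G);
  exterior_up : forall F G, exterior F -> open G -> F `<=` G -> exterior G }.

Definition exterior_map (X Y : extSpace) (f : X -> Y) : Prop :=
  continuous f /\ forall F, exterior F -> exterior (f @^-1` F).

Definition E : concreteCat :=
  @ConcreteCat extSpace (fun X => X) exterior_map.

Section Cocompact.
Variables (X : topologicalType) (hX : cgwh X).

Definition cocompact_sets : set (set X) :=
  [set F | exists K, [/\ closed K, compact K & F = ~` K]].

Lemma cocompact_nonempty : cocompact_sets !=set0.
Proof. by exists (~` set0), set0; split => //; [exact: closed0|exact: compact0]. Qed.

Lemma cocompact_open F : cocompact_sets F -> open F.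
Proof. by move=> [K [cK _ ->]]; exact: closed_openC. Qed.

Lemma cocompactI F G :
  cocompact_sets F -> cocompact_sets G -> cocompact_sets (F `&` G).
Proof.
move=> [K [clK cK ->]] [L [clL cL ->]]; exists (K `|` L); split.
- exact: closedU.
- exact: compactU.
- by rewrite setCU.
Qed.

Lemma cocompact_up F G :
  cocompact_sets F -> open G -> F `<=` G -> cocompact_sets G.
Proof.
move=> [K [clK cK ->]] oG KG; exists (~` G); split.
- exact: open_closedC.
- apply: (subclosed_compact _ cK); first exact: open_closedC.
  by move=> x nGx; apply: contrapT => nKx; apply/nGx/KG.
- by rewrite setCK.
Qed.

Definition cocompact : extSpace :=
  ExtSpace hX cocompact_nonempty cocompact_open cocompactI cocompact_up.

End Cocompact.

(* [X] times [Y] carries the product topology.  The product of compactly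
   generated spaces is the k-ification of the product topology; the two agree
   as soon as the latter is compactly generated, as [hXY] requires. *)
Section Bar.
Variables (X : extSpace) (Y : topologicalType) (hXY : cgwh (X * Y)%type).

Definition bar_sets : set (set (X * Y)) :=
  [set W | open W /\ forall y : Y, exists (F : set X) (U : set Y),
    [/\ exterior F, open U, U y & F `*` U `<=` W]].

Lemma bar_nonempty : bar_sets !=set0.
Proof.
exists setT; split=> [|y]; first exact: openT.
have [F eF] := exterior_nonempty X.
by exists F, setT; split => //; exact: openT.
Qed.

Lemma bar_open F : bar_sets F -> open F. Proof. by case. Qed.

Lemma barI F G : bar_sets F -> bar_sets G -> bar_sets (F `&` G).
Proof.
move=> [oF hF] [oG hG]; split=> [|y]; first exact: openI.
have [A [U [eA oU Uy AU]]] := hF y; have [B [V [eB oV Vy BV]]] := hG y.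
exists (A `&` B), (U `&` V); split => //.
- exact: exteriorI.
- exact: openI.
- by move=> [a b] [[/= ? ?] [? ?]]; split; [apply: AU|apply: BV].
Qed.

Lemma bar_up F G : bar_sets F -> open G -> F `<=` G -> bar_sets G.
Proof.
move=> [oF hF] oG FG; split=> // y.
have [A [U [eA oU Uy AU]]] := hF y; exists A, U; split => //.
exact: subset_trans AU FG.
Qed.

Definition bar : extSpace := ExtSpace hXY bar_nonempty bar_open barI bar_up.

End Bar.

Lemma compact_set_val (T : topologicalType) (A K : set T) :
  closed A -> compact K -> compact (set_val @^-1` K : set A).
Proof.
move=> clA cK F PF FK.
have PG : ProperFilter (fmap (set_val : A -> T) F) by exact: fmap_proper_filter.
have GK : fmap (set_val : A -> T) F K by rewrite /fmap /=.
have [p [Kp clp]] := cK _ PG GK.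
have Ap : A p.
  apply: clA; move=> B Bp.
  have GA : fmap (set_val : A -> T) F A.
    by rewrite /fmap /=; apply: filterS filterT => x _; exact: set_valP.
  exact: clp GA Bp.
exists (exist _ p (mem_set Ap)); split; first by rewrite /= set_valE.
move=> B C FB [W [[V oV <-]] /= Vp VC].
have GB : fmap (set_val : A -> T) F (set_val @` B).
  by rewrite /fmap /=; apply: filterS FB => x Bx; exists x.
rewrite set_valE /= in Vp.
have [q [[x Bx <-] Vx]] := clp _ _ GB (open_nbhs_nbhs (conj oV Vp)).
by exists x; split => //; apply: VC.
Qed.

Lemma hausdorff_set_type (T : topologicalType) (A : set T) :
  hausdorff_space T -> hausdorff_space A.
Proof.
move=> hT x y cxy; apply: val_inj; apply: hT => U V Ux Vy.
have [z [Uz Vz]] : (set_val @^-1` U : set A) `&` set_val @^-1` V !=set0.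
  by apply: cxy; [move: U Ux|move: V Vy]; exact: initial_continuous.
by exists (set_val z).
Qed.

Lemma cgwh_locally_compact (T : topologicalType) :
  hausdorff_space T -> (forall x : T, exists2 K, compact K & nbhs x K) -> cgwh T.
Proof.
move=> hT lT; split=> [A hA x clx|K f cK _ cf]; last first.
  apply: compact_closed => //; apply: continuous_compact => //.
  exact: continuous_subspaceT.
have [K cK nK] := lT x.
have clK : closed K by exact: compact_closed.
have cKT : compact [set: K].
  have -> : [set: K] = set_val @^-1` K.
    by apply/seteqP; split => // y _; exact: set_valP.
  exact: compact_set_val.
have /= clAK := hA _ (set_val : K -> T) cKT (hausdorff_set_type (A := K) hT)
  (@initial_continuous _ _ _).
have Kx : K x := nbhs_singleton nK.
suff : (set_val @^-1` A : set K) (exist _ x (mem_set Kx)) by rewrite /= set_valE.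
apply: clAK => B [W [[V oV <-]] /= Vx VB]; rewrite set_valE /= in Vx.
have [a [Aa [Va Ka]]] := clx _ (filterI (open_nbhs_nbhs (conj oV Vx)) nK).
exists (exist _ a (mem_set Ka)); split; first by rewrite /= set_valE.
by apply: VB; rewrite /= set_valE.
Qed.

Section Spaces.
Variable R : realType.

Definition Rplus : set R := [set x | 0 <= x].

Lemma cgwh_Rplus : cgwh Rplus.
Proof.
apply: cgwh_locally_compact.
  exact/hausdorff_set_type/Rhausdorff.
move=> x; exists (set_val @^-1` `[set_val x - 1, set_val x + 1]%classic).
  apply: compact_set_val; last exact: segment_compact.
  exact: closed_ge.
apply: (@initial_continuous _ _ set_val x).
have xI : set_val x \in `]set_val x - 1, set_val x + 1[.
  by rewrite in_itv /= ltrBlDr !ltrDl ltr01.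
apply: filterS (near_in_itvoo xI) => y.
exact: subset_itv_oo_cc.
Qed.

Definition ERplus : extSpace := cocompact cgwh_Rplus.

Lemma cgwh_nat : cgwh nat.
Proof.
apply: cgwh_locally_compact; first exact: discrete_hausdorff.
by move=> n; exists [set n]; [exact: compact_set1|exact: discrete_set1].
Qed.

Definition Enat : extSpace := cocompact cgwh_nat.

Definition sqnorm n (x : 'rV[R]_n) : R := \sum_(i < n) x ord0 i ^+ 2.

Definition disc n : set 'rV[R]_n := [set x | sqnorm x <= 1].
Arguments disc : clear implicits.

(* [sphere n] is the boundary of the [n]-disc, i.e. the (n-1)-sphere; it is
   empty for [n = 0]. *)
Definition sphere n : set (disc n) := [set x | sqnorm (set_val x) = 1].
Arguments sphere : clear implicits.

Lemma sqnorm_continuous n : continuous (@sqnorm n).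
Proof.
have sum_continuous (r : seq 'I_n) :
    continuous (fun x : 'rV[R]_n => \sum_(i <- r) x ord0 i ^+ 2).
  have cx (i : 'I_n) : continuous (fun x : 'rV[R]_n => x ord0 i).
    exact: coord_continuous.
  elim: r => [|i r IHr].
    rewrite [X in continuous X](_ : _ = cst 0); first exact: cst_continuous.
    by apply/funext => x; rewrite big_nil.
  rewrite [X in continuous X](_ : _ = fun x : 'rV[R]_n =>
      x ord0 i * x ord0 i + \sum_(i <- r) x ord0 i ^+ 2).
    move=> x; exact: (cvgD (cvgM (cx i x) (cx i x)) (IHr x)).
  by apply/funext => x; rewrite big_cons expr2.
exact: sum_continuous.
Qed.

Lemma disc_closed n : closed (disc n).
Proof.
apply: (preimage_closed (f := @sqnorm n) (D := [set y | y <= 1])).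
  by move=> x _; exact: sqnorm_continuous.
exact: closed_le.
Qed.

Lemma disc_compact n : compact [set: disc n].
Proof.
have -> : [set: disc n] = set_val @^-1` disc n.
  by apply/seteqP; split => // y _; exact: set_valP.
apply: compact_set_val; first exact: disc_closed.
apply: bounded_closed_compact (@disc_closed n).
exists 1; split; first exact: real1.
move=> M M1 x /= xD; apply: le_trans (ltW M1).
rewrite /Num.norm /=.
have [->|/mx_norm_neq0[[i j] ->] /=] := eqVneq (mx_norm x) 0; first exact: ler01.
rewrite -(@ler_pXn2r _ 2) ?nnegrE // expr1n real_normK ?num_real //.
apply: le_trans xD; rewrite /sqnorm (bigD1 j) //= (ord1 i) lerDl.
by apply: sumr_ge0 => k _; exact: sqr_ge0.
Qed.

Lemma sphere_compact n : compact [set: sphere n].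
Proof.
have -> : [set: sphere n] = set_val @^-1` [set: disc n] by [].
apply: compact_set_val; last exact: disc_compact.
apply: (preimage_closed (f := (@sqnorm n) \o set_val) (D := [set y | y = 1])).
  move=> x _; apply: continuous_comp; last exact: sqnorm_continuous.
  exact: initial_continuous.
exact: closed_eq.
Qed.

Lemma hausdorff_disc n : hausdorff_space (disc n).
Proof. exact/hausdorff_set_type/norm_hausdorff. Qed.

Lemma cgwh_nat_prod (Y : topologicalType) :
  compact [set: Y] -> hausdorff_space Y -> cgwh (nat * Y)%type.
Proof.
move=> cY hY; apply: cgwh_locally_compact => [[m x] [n y] cxy|[n y]].
  have -> : m = n.
    apply: (discrete_hausdorff (T := nat)) => U V Um Vn.
    have [[a b] [/= Ua Va]] : (fst @^-1` U : set (nat * Y)) `&` fst @^-1` V !=set0.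
      by apply: cxy; [exact: (@cvg_fst _ _ _ _ _ U)|exact: (@cvg_fst _ _ _ _ _ V)].
    by exists a.
  have -> // : x = y.
  apply: hY => U V Ux Vy.
  have [[a b] [/= Ub Vb]] : (snd @^-1` U : set (nat * Y)) `&` snd @^-1` V !=set0.
    by apply: cxy; [exact: (@cvg_snd _ _ _ _ _ U)|exact: (@cvg_snd _ _ _ _ _ V)].
  by exists b.
exists ([set n] `*` [set: Y]).
  by apply: compact_setX => //; exact: compact_set1.
exists ([set n], [set: Y]) => //=; split; first exact: discrete_set1.
exact: filterT.
Qed.

Definition Nsphere n : extSpace :=
  bar (X := Enat)
    (cgwh_nat_prod (@sphere_compact n) (hausdorff_set_type (@hausdorff_disc n))).

Definition Ndisc n : extSpace :=
  bar (X := Enat) (cgwh_nat_prod (@disc_compact n) (@hausdorff_disc n)).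

Definition gen_cof n (p : Nsphere n) : Ndisc n := (p.1, set_val p.2).

(* A cell sequence indexed by a well-ordered [W] with bottom and top is a
   transfinite sequence of pushouts of generating cofibrations, continuous at
   limits, with its colimit adjoined as the top stage. *)
Record cellSequence d (W : tbOrderType d) := CellSequence {
  index_wf : well_founded (fun a b : W => (a < b)%O);
  stage : W -> extSpace;
  stage_map : forall a b : W, (a <= b)%O -> stage a -> stage b;
  stage_map_ext : forall a b (ab : (a <= b)%O), exterior_map (stage_map ab);
  stage_map_id : forall a (aa : (a <= a)%O), stage_map aa = id;
  stage_map_comp : forall a b c (ab : (a <= b)%O) (bc : (b <= c)%O)
    (ac : (a <= c)%O), stage_map bc \o stage_map ab = stage_map ac;
  stage_succ : forall a b (ab : (a < b)%O),
    (forall c, ~~ (a < c < b)%O) ->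
    exists n (f : Nsphere n -> stage a) (g : Ndisc n -> stage b),
      is_pushout (K := E) (@gen_cof n) f g (stage_map (ltW ab));
  stage_lim : forall b : W, b != \bot%O ->
    (forall a, (a < b)%O -> exists c, (a < c < b)%O) ->
    forall (T : extSpace) (u : forall a, (a < b)%O -> stage a -> T),
      (forall a (ab : (a < b)%O), exterior_map (u a ab)) ->
      (forall a a' (aa' : (a <= a')%O) (ab : (a < b)%O) (a'b : (a' < b)%O),
        u a' a'b \o stage_map aa' = u a ab) ->
      exists! w : stage b -> T, exterior_map w /\
        forall a (ab : (a < b)%O), w \o stage_map (ltW ab) = u a ab }.

Arguments stage_map {d W} _ {a b} ab _.

Definition cofibration (A B : extSpace) (f : A -> B) : Prop :=
  exterior_map f /\
  exists d (W : tbOrderType d) (S : cellSequence W),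
    is_retract (K := E) f (stage_map S (lex1 (\bot%O : W))).

Definition in_Estar (X : extSpace) (s : ERplus -> X) (r : X -> ERplus) : Prop :=
  [/\ exterior_map s, exterior_map r & r \o s = id].

(* The initial object of E_* is (ERplus, id, id), and its unique map to
   (X, s, r) has underlying map [s]; so [X] is cofibrant iff [s] is a
   cofibration. *)
Definition in_Cstar (X : extSpace) (s : ERplus -> X) (r : X -> ERplus) : Prop :=
  in_Estar s r /\ cofibration s.

Definition sum_boundary n (I : choiceType)
    (z : {c : I & sphere n}) : {c : I & disc n} :=
  existT _ (projT1 z) (set_val (projT2 z)).

(* [prev_skel A sk n] is the (n-1)-skeleton, where [sk n] is the [n]-skeleton
   and [A] is the (-1)-skeleton. *)
Definition prev_skel (A : topologicalType) (sk : nat -> topologicalType)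
    (n : nat) : topologicalType :=
  if n is m.+1 then sk m else A.

(* [i : A -> X] exhibits [(X, A)] as a relative cell complex: [X] is the
   colimit of its skeleta, and the [n]-skeleton arises from the (n-1)-skeleton
   by attaching [n]-discs along their boundaries. *)
Record relCellComplex (A X : topologicalType) (i : A -> X) := RelCellComplex {
  skel : nat -> topologicalType;
  skel_map : forall n, prev_skel A skel n -> skel n;
  skel_in : forall n, skel n -> X;
  cell : nat -> choiceType;
  attach : forall n, {c : cell n & sphere n} -> prev_skel A skel n;
  charac : forall n, {c : cell n & disc n} -> skel n;
  skel_in_cont : forall n, continuous (@skel_in n);
  skel_in0 : @skel_in 0 \o @skel_map 0 = i;
  skel_inS : forall n, @skel_in n.+1 \o @skel_map n.+1 = @skel_in n;
  skel_pushout : forall n,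
    is_pushout (K := Top) (@sum_boundary n (cell n))
      (@attach n) (@charac n) (@skel_map n);
  skel_colimit : forall (T : topologicalType) (u : forall n, skel n -> T),
    (forall n, continuous (u n)) ->
    (forall n, u n.+1 \o @skel_map n.+1 = u n) ->
    exists! w : X -> T, continuous w /\ forall n, w \o @skel_in n = u n }.

Section CellComplex.
Variables (A X : topologicalType) (i : A -> X) (C : relCellComplex i).

Definition closed_cell n (c : cell C n) : set X :=
  range (fun x : disc n => skel_in (charac (existT _ c x))).

Definition finite_dimensional : Prop :=
  exists d, forall n, (d < n)%N -> cell C n -> False.

Definition locally_finite : Prop :=
  forall x : X, exists2 U, nbhs x U &
    finite_set [set e : {n : nat & cell C n} |
      U `&` closed_cell (projT2 e) !=set0].

Definition countably_many_cells : Prop :=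
  forall n, countable [set: cell C n].

End CellComplex.

End Spaces.

Arguments Rplus : clear implicits.
Arguments ERplus : clear implicits.
Arguments disc : clear implicits.
Arguments sphere : clear implicits.
Arguments Nsphere : clear implicits.
Arguments Ndisc : clear implicits.
Arguments gen_cof : clear implicits.
Arguments stage_map {R d W} _ {a b} ab _.
Arguments cofibration R {A B} f.
Arguments relCellComplex R {A X} i.

(* Main.v *)
Require Import Defs.
From HB Require Import structures.
From mathcomp Require Import all_boot all_order all_algebra.
From mathcomp Require Import all_classical all_reals topology normedtype.
From mathcomp Require Import numfun derive.

(** The difficulty is that a generating cofibration attaches countably many
    discs at once, escaping to infinity, whereas [X] may have only finitely many
    cells in some dimension, and one cell cannot be attached alone.  So the
    complex is multiplied by [nat]: in [X * nat] every dimension that has cells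
    at all has exactly countably infinitely many of them, one for each pair of a
    cell and a natural number, and [s] is recovered as a retract.

    Everything is measured by a proper function.  A gauge on a space is a
    continuous real function with compact sublevel sets; the exterior sets of
    the cocompact externology are then the open sets containing some
    superlevel set, so a continuous map that preserves gauges is exterior.

    - [proper_retraction] builds [rho : X -> Rplus R] with [rho \o s = id] such
      that [rho] is a gauge.  It is defined cell by cell ([extend_cellwise]):
      over the cell with number [j] in its dimension, the values on the boundary
      are extended by Tietze's theorem so as to stay above their minimum, or to
      be equal to [j] when the boundary is empty ([disc_extension]).  By
      induction on the dimension, each sublevel set meets finitely many cells:
      unless its number is small, such a cell has a boundary point in the
      sublevel set of the skeleton below, which is compact, and a compact set
      meets finitely many cells.

    - [X * nat] has the gauge [H (x, j) = rho x + j].  The ray [s] is a retract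
      of the inclusion of [range s * nat] into [X * nat]: on the left,
      [u |-> (s u, 0)] is retracted by [shift], which is [H] with values in the
      half-line; on the right, [x |-> (x, 0)] is
      retracted by [fold], which keeps the copy of index [0] and sends
      [(x, j)] to [s (shift (x, j))] for [0 < j].  All four maps preserve the
      gauges ([base_retract_thick_incl]).

    - The inclusion of [range s * nat] into [X * nat] is a finite composite of
      pushouts of generating cofibrations, one for each dimension that has a
      cell ([thick_pushout]).  The universal property is checked by hand
      ([cell_pushout]): a map on the larger space is defined by gluing, and is
      continuous and exterior because the gauge tends to infinity along the
      family of attached discs.

    All stages are closed subsets of [X * nat], so that none of the spaces needs
    to be constructed as a quotient; the disjointness of the open cells of [X]
    is extracted from the universal properties ([cell_coordinates]). *)

Set Implicit Arguments.
Unset Strict Implicit.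
Unset Printing Implicit Defensive.

Import Order.TTheory GRing.Theory Num.Theory numFieldNormedType.Exports.
Local Open Scope classical_set_scope.
Local Open Scope ring_scope.

(** * Continuity and compactness *)

Lemma set_val_continuous (T : topologicalType) (A : set T) :
  continuous (set_val : A -> T).
Proof. exact: initial_continuous. Qed.

Lemma set_type_continuous (S T : topologicalType) (A : set T) (f : S -> A) :
  continuous (set_val \o f) -> continuous f.
Proof. exact: continuous_comp_initial. Qed.

Lemma set_type_inj (T : Type) (A : set T) : injective (set_val : A -> T).
Proof. exact: val_inj. Qed.

Lemma comp_continuous (R S T : topologicalType) (f : R -> S) (g : S -> T) :
  continuous f -> continuous g -> continuous (g \o f).
Proof. by move=> cf cg x; exact: (continuous_comp (cf x) (cg (f x))). Qed.

Lemma open_preimage (S T : topologicalType) (f : S -> T) (A : set T) :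
  continuous f -> open A -> open (f @^-1` A).
Proof. by move=> /continuousP; exact. Qed.

Lemma closed_preimage (S T : topologicalType) (f : S -> T) (A : set T) :
  continuous f -> closed A -> closed (f @^-1` A).
Proof. by move=> /continuous_closedP; exact. Qed.

Lemma closed_set_val (T : topologicalType) (A : set T) (B : set A) :
  closed A -> closed B -> closed (set_val @` B).
Proof.
move=> clA /closed_openC [O oO OB].
have -> : set_val @` B = A `&` ~` O.
  apply/seteqP; split=> [_ [x Bx <-]|x [Ax nOx]].
    split; first exact: set_valP.
    by move=> Ox; have : (~` B) x by rewrite -OB.
  exists (exist _ x (mem_set Ax)) => //.
  apply: contrapT => nB.
  have : (~` B) (exist _ x (mem_set Ax)) by [].
  by rewrite -OB /= set_valE.
by apply: closedI => //; exact: open_closedC.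
Qed.

Lemma compact_setT_val (T : topologicalType) (A : set T) :
  closed A -> compact A -> compact [set: A].
Proof.
move=> clA cA; have -> : [set: A] = set_val @^-1` A.
  by apply/seteqP; split => // y _; exact: set_valP.
exact: compact_set_val.
Qed.

Lemma continuous_pair (S T U : topologicalType) (f : S -> T) (g : S -> U) :
  continuous f -> continuous g -> continuous (fun x => (f x, g x)).
Proof. by move=> cf cg x; apply: cvg_pair; [exact: cf|exact: cg]. Qed.

Lemma continuous_nat_prod (Y T : topologicalType) (f : nat * Y -> T) :
  (forall n, continuous (fun y => f (n, y))) -> continuous f.
Proof.
move=> cf [n y] V /= nV; have /= nU := cf n y V nV.
exists ([set n], (fun y => f (n, y)) @^-1` V) => /=.
  by split; first exact: discrete_set1.
by move=> [m z] /= [-> ].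
Qed.

Lemma continuous_prod_nat (Y T : topologicalType) (f : Y * nat -> T) :
  (forall n, continuous (fun y => f (y, n))) -> continuous f.
Proof.
move=> cf [y n] V /= nV; have /= nU := cf n y V nV.
exists ((fun y => f (y, n)) @^-1` V, [set n]) => /=.
  by split; last exact: discrete_set1.
by move=> [z m] /= [+ ->].
Qed.

(** A family of sets that is locally finite along a compact set [K] has finitely
    many members meeting [K].  The near-covering form of compactness is applied
    to the filter of all large enough finite subsets of [I]: near each point a
    finite set of indices suffices, hence some finite set suffices for all of
    [K] at once. *)
Lemma compact_locally_finite (T : topologicalType) (I : Type) (A : I -> set T)
    (K : set T) :
  compact K ->
  (forall x, K x -> exists2 U, nbhs x U &
     finite_set [set i | U `&` A i !=set0]) ->
  finite_set [set i | K `&` A i !=set0].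
Proof.
move=> /compact_near_coveringP cK lf.
pose F : set_system (set I) := [set P | exists2 S0 : set I, finite_set S0 &
  forall S, finite_set S -> S0 `<=` S -> P S].
have FF : Filter F.
  split=> [|P Q [S fS PS] [S' fS' QS']|P Q PQ [S fS PS]].
  - by exists set0.
  - exists (S `|` S'); first by rewrite finite_setU.
    move=> V fV SV; split; [apply: PS|apply: QS'] => //.
      by move=> i Si; apply: SV; left.
    by move=> i Si; apply: SV; right.
  - by exists S => // V fV SV; apply: PQ; apply: PS.
have [x Kx|S0 fS0 S0P] :=
    cK _ F (fun S x => finite_set S /\ forall i, A i x -> S i) FF.
  have [U nU fU] := lf x Kx.
  exists (U, [set S | finite_set S /\ [set i | U `&` A i !=set0] `<=` S]) => /=.
    by split => //; exists [set i | U `&` A i !=set0].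
  move=> [y S] /= [Uy [fS US]]; split=> // i Aiy.
  by apply: US; exists y.
apply: sub_finite_set (fS0) => i [x [Kx Aix]].
by have /(_ x Kx) [_] := S0P S0 fS0 (@subset_refl _ _); exact.
Qed.

(** * Compactly generated weakly Hausdorff spaces *)

Lemma weakly_hausdorff_compact_image (X Y : topologicalType) (f : Y -> X)
    (A : set Y) :
  weakly_hausdorff X -> hausdorff_space Y -> compact A -> continuous f ->
  closed (f @` A).
Proof.
move=> whX hY cA cf.
have -> : f @` A = range (f \o (set_val : A -> Y)).
  apply/seteqP; split=> [_ [x Ax <-]|_ [x _ <-]].
    by exists (exist _ x (mem_set Ax)).
  by exists (set_val x) => //; exact: set_valP.
apply: whX.
- by apply: compact_setT_val => //; exact: compact_closed.
- exact: hausdorff_set_type.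
- by apply: comp_continuous => //; exact: set_val_continuous.
Qed.

(** Closedness of the subset is what makes compact generation inherited: a test
    map into the whole space restricts to a compact test space over [A]. *)
Lemma cgwh_closed_subset (X : topologicalType) (A : set X) :
  cgwh X -> closed A -> cgwh A.
Proof.
move=> [cgX whX] clA; split=> [B hB|K f cK hK cf]; last first.
  have -> : range f = set_val @^-1` (range (set_val \o f)).
    apply/seteqP; split=> [_ [x _ <-]|y [x _ /set_type_inj <-]]; by exists x.
  apply: closed_preimage; first exact: set_val_continuous.
  by apply: whX => //; apply: comp_continuous => //; exact: set_val_continuous.
have -> : B = set_val @^-1` (set_val @` B).
  apply/seteqP; split=> [y By|y [z Bz /set_type_inj <-] //]; by exists y.
apply: closed_preimage; first exact: set_val_continuous.
apply: cgX => K g cK hK cg.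
(* The part of [K] over [A] is again a compact Hausdorff test space. *)
pose L : set K := g @^-1` A.
have clL : closed L by exact: closed_preimage.
pose gL (x : L) : A := exist _ (g (set_val x)) (mem_set (set_valP x)).
have -> : g @^-1` (set_val @` B) = set_val @` (gL @^-1` B).
  apply/seteqP; split=> [x [b Bb bgx]|_ [x Bx <-]]; last by exists (gL x).
  have Lx : L x by rewrite /L /= -bgx; exact: set_valP.
  exists (exist _ x (mem_set Lx)) => //=.
  by congr B : Bb; apply: set_type_inj; rewrite bgx.
apply: closed_set_val => //; apply: hB.
- by apply: compact_setT_val => //; apply: (subclosed_compact clL cK).
- exact: hausdorff_set_type.
- apply: set_type_continuous.
  by apply: (comp_continuous (f := set_val)) => //; exact: set_val_continuous.
Qed.

Lemma closed_prod_nat (X : topologicalType) (A : set (X * nat)) :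
  (forall n, closed [set x | A (x, n)]) -> closed A.
Proof.
move=> clA; rewrite -[A]setCK; apply: open_closedC.
rewrite openE => -[x n] nA.
have /closed_openC := clA n; rewrite openE => /(_ x nA) nU.
exists (~` [set x | A (x, n)], [set n]) => /=.
  by split; last exact: discrete_set1.
by move=> [y m] /= [+ ->].
Qed.

Lemma cgwh_prod_nat (X : topologicalType) : cgwh X -> cgwh (X * nat)%type.
Proof.
move=> [cgX whX]; split=> [A hA|K f cK hK cf]; apply: closed_prod_nat => n.
  apply: cgX => K g cK hK cg.
  apply: (hA K (fun x => (g x, n)) cK hK).
  by apply: continuous_pair => // x; exact: cvg_cst.
have cf2 : continuous (snd \o f).
  by apply: comp_continuous => // -[a b]; exact: cvg_snd.
have -> : [set x | range f (x, n)] = (fst \o f) @` ((snd \o f) @^-1` [set n]).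
  apply/seteqP; split=> [x [k _ fk]|_ [k /= fk <-]].
    by exists k; rewrite /= fk.
  by exists k => //; rewrite -fk; case: (f k).
apply: weakly_hausdorff_compact_image => //.
  apply: (subclosed_compact _ cK) => //.
  by apply: closed_preimage => //; exact: discrete_closed.
by apply: comp_continuous => // -[a b]; exact: cvg_fst.
Qed.

(** * Gauges and the cocompact externology *)

Section Gauge.
Variable R : realType.

Lemma compact_ubound (Y : topologicalType) (h : Y -> R) (K : set Y) :
  continuous h -> compact K -> exists t, forall y, K y -> h y <= t.
Proof.
move=> ch cK.
have /(@compact_bounded R R^o) [M [_ HM]] : compact (h @` K).
  by apply: continuous_compact => //; exact: continuous_subspaceT.
exists (M + 1) => y Ky; apply: le_trans (ler_norm _) _.
by apply: (HM (M + 1)); [rewrite ltrDl|exists y].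
Qed.

(** A proper function; its superlevel sets form a base of the cocompact
    externology, which reduces statements about exterior sets to inequalities. *)
Definition gauge (Y : topologicalType) (h : Y -> R) : Prop :=
  continuous h /\ forall t, compact [set y | h y <= t].

Lemma gauge_closed_sublevel (Y : topologicalType) (h : Y -> R) t :
  continuous h -> closed [set y | h y <= t].
Proof.
move=> ch; apply: (closed_preimage (A := [set z : R | z <= t]) ch).
exact: closed_le.
Qed.

Lemma gauge_exteriorP (Y : topologicalType) (hY : cgwh Y) (h : Y -> R) F :
  gauge h -> exterior (e := cocompact hY) F <->
    open F /\ exists t, forall y, t < h y -> F y.
Proof.
move=> [ch hc]; split=> [[K [clK cK ->]]|[oF [t tF]]].
  split; first exact: closed_openC.
  have [t tK] := compact_ubound ch cK.
  by exists t => y ty Ky; have := tK y Ky; rewrite leNgt ty.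
exists (~` F); split; last by rewrite setCK.
  exact: open_closedC.
apply: (subclosed_compact _ (hc t)); first exact: open_closedC.
by move=> y nFy /=; rewrite leNgt; apply/negP => /tF.
Qed.

Lemma gauge_exterior_map (Y Z : topologicalType) (hY : cgwh Y) (hZ : cgwh Z)
    (kY : Y -> R) (kZ : Z -> R) (f : Y -> Z) :
  gauge kY -> gauge kZ -> continuous f -> (forall y, kZ (f y) = kY y) ->
  exterior_map (X := cocompact hY) (Y := cocompact hZ) f.
Proof.
move=> gY gZ cf kf; split=> // F /(gauge_exteriorP _ gZ) [oF [t tF]].
apply/(gauge_exteriorP _ gY); split; first exact: open_preimage cf oF.
by exists t => y ty; apply: tF; rewrite kf.
Qed.

(** A continuous function is locally bounded, so a set is closed as soon as its traces on the
    sublevel sets are; this turns locally finite unions into finite ones. *)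
Lemma gauge_closed (Y : topologicalType) (h : Y -> R) (A : set Y) :
  continuous h -> (forall t, closed (A `&` [set y | h y <= t])) -> closed A.
Proof.
move=> ch clA p Ap; apply: (proj1 (clA (h p + 1) p _)) => U nU.
have nV : nbhs p (h @^-1` [set z : R | z < h p + 1]).
  apply: (ch p); apply: open_nbhs_nbhs; split; first exact: open_lt.
  by rewrite /= ltrDl.
have [q [Aq [Uq hq]]] := Ap _ (filterI nU nV).
by exists q; split => //; split => //; exact: ltW.
Qed.

Lemma gauge_set_val (Y : topologicalType) (h : Y -> R) (A : set Y) :
  closed A -> gauge h -> gauge (h \o (set_val : A -> Y)).
Proof.
move=> clA [ch hc]; split=> [|t].
  by apply: comp_continuous => //; exact: set_val_continuous.
exact: compact_set_val (hc t).
Qed.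

Lemma gauge_prod_nat (Y : topologicalType) (h : Y -> R) :
  gauge h -> (forall y, 0 <= h y) ->
  gauge (fun p : Y * nat => h p.1 + p.2%:R).
Proof.
move=> [ch hc] h0.
have cH : continuous (fun p : Y * nat => h p.1 + p.2%:R).
  apply: continuous_prod_nat => n y; apply: (@cvgD R R^o); first exact: ch.
  exact: cvg_cst.
split=> // t.
have [N tN] : exists N : nat, t <= N%:R.
  exists (Num.bound `|t|); apply/ltW/(le_lt_trans (ler_norm t)).
  exact: archi_boundP (normr_ge0 t).
apply: (@subclosed_compact _ _ ([set y | h y <= t] `*` `I_N.+1)).
- exact: gauge_closed_sublevel.
- by apply: compact_setX => //; apply: finite_compact; exact: finite_II.
- move=> [y n] /= Ht; split => /=.
    by apply: le_trans Ht; rewrite lerDl.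
  rewrite ltnS -(ler_nat R); apply: le_trans tN; apply: le_trans Ht.
  by rewrite lerDr.
Qed.

Lemma compact_nat_finite (K : set nat) : compact K -> finite_set K.
Proof.
move=> cK; have := compact_locally_finite (A := fun i : nat => [set i]) cK.
move=> H; apply: sub_finite_set (H _) => [k Kk|k _]; first by exists k.
exists [set k]; first exact: discrete_set1.
apply: sub_finite_set (finite_set1 k) => i [x [/= -> ->]] //.
Qed.

(** When [Y] is compact, the pointwise condition defining the exterior sets of
    [nat] bar-times [Y] becomes uniform: such a set contains all but finitely
    many of the copies of [Y]. *)
Lemma bar_nat_exteriorP (Y : topologicalType) (hY : cgwh (nat * Y)%type)
    (W : set (nat * Y)) :
  compact [set: Y] ->
  exterior (e := bar (X := Enat) hY) W <->
  open W /\ finite_set [set k | exists y, ~ W (k, y)].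
Proof.
move=> cY; split=> [[oW hW]|[oW fW]]; split=> //.
  have H := compact_locally_finite (A := fun k => [set y | ~ W (k, y)]) cY.
  apply: sub_finite_set (H _) => [k [y nW]|y _]; first by exists y.
  have [F [U [[K [_ cK ->]] oU Uy FU]]] := hW y.
  exists U; first exact: open_nbhs_nbhs.
  apply: sub_finite_set (compact_nat_finite cK) => k [z [Uz nW]].
  by apply: contrapT => nK; apply/nW/FU.
move=> y; set S := [set k | _] in fW; exists (~` S), setT; split=> //.
- by exists S; split => //; [exact: (@discrete_closed nat S)|exact: finite_compact fW].
- exact: openT.
- by move=> [k z] [/= nk _]; apply: contrapT => nW; apply: nk; exists z.
Qed.

Lemma gen_cof_exterior n : exterior_map (gen_cof R n).
Proof.
have cg : continuous (gen_cof R n).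
  apply: continuous_nat_prod => k.
  exact: (continuous_pair (@cst_continuous _ _ k) (@set_val_continuous _ _)).
split=> // F /(bar_nat_exteriorP _ _ (@disc_compact R n)) [oF fF].
apply/(bar_nat_exteriorP _ _ (@sphere_compact R n)).
split; first exact: open_preimage cg oF.
by apply: sub_finite_set fF => k [y nF]; exists (set_val y).
Qed.

(** * Attaching a sequence of discs *)

Section Pushout.
Variables (n : nat) (A B : topologicalType) (hA : cgwh A) (hB : cgwh B).
Variables (kB : B -> R) (i : A -> B).
Variables (f : nat * sphere R n -> A) (g : nat * disc R n -> B).
Hypotheses (gB : gauge kB) (gA : gauge (kB \o i)).
Hypotheses (ci : continuous i) (i_inj : injective i).
Hypothesis i_closed : forall P, closed P -> closed (i @` P).
Hypotheses (cf : continuous f) (cg : continuous g).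
Hypothesis gf : forall k x, g (k, set_val x) = i (f (k, x)).
Hypothesis g_proper : forall t, finite_set [set k | exists x, kB (g (k, x)) <= t].
Hypothesis ig_surj : forall b,
  (exists a, b = i a) \/ exists k x, ~ sphere R n x /\ b = g (k, x).
Hypothesis ig_disj : forall k x a, ~ sphere R n x -> g (k, x) <> i a.
Hypothesis g_inj : forall k x k' x', ~ sphere R n x -> ~ sphere R n x' ->
  g (k, x) = g (k', x') -> (k, x) = (k', x').

Let f_exterior : exterior_map (X := Nsphere R n) (Y := cocompact hA) f.
Proof.
split=> // F /(gauge_exteriorP _ gA) [oF [t tF]].
apply/(bar_nat_exteriorP _ _ (@sphere_compact R n)).
split; first exact: open_preimage cf oF.
apply: sub_finite_set (g_proper t) => k [x nF]; exists (set_val x).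
by rewrite gf leNgt; apply/negP => /tF.
Qed.

Let g_exterior : exterior_map (X := Ndisc R n) (Y := cocompact hB) g.
Proof.
split=> // F /(gauge_exteriorP _ gB) [oF [t tF]].
apply/(bar_nat_exteriorP _ _ (@disc_compact R n)).
split; first exact: open_preimage cg oF.
apply: sub_finite_set (g_proper t) => k [x nF]; exists x.
by rewrite leNgt; apply/negP => /tF.
Qed.

Section Glue.
Variables (T : extSpace) (u : nat * disc R n -> T) (v : A -> T) (w : B -> T).
Hypothesis u_ext : exterior_map (X := Ndisc R n) u.
Hypothesis v_ext : exterior_map (X := cocompact hA) v.
Hypotheses (wi : forall a, w (i a) = v a) (wg : forall p, w (g p) = u p).

Let w_cover b : (exists a, b = i a) \/ exists p, b = g p.
Proof. by have [?|[k [x [_ ->]]]] := ig_surj b; [left|right; exists (k, x)]. Qed.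

Lemma glue_continuous : continuous w.
Proof.
apply/continuous_closedP => Q clQ; apply: (gauge_closed gB.1) => t.
pose S := [set k | exists x, kB (g (k, x)) <= t].
pose gk k := (fun x => g (k, x)) @` [set x | Q (u (k, x))].
(* Over a sublevel of the gauge only finitely many discs contribute. *)
have -> : w @^-1` Q `&` [set y | kB y <= t] =
    (i @` (v @^-1` Q) `|` \bigcup_(k in S) gk k) `&` [set y | kB y <= t].
  apply/seteqP; split=> b [bQ bt]; split=> //.
    have [[a ba]|[[k x] bg]] := w_cover b.
      by left; exists a => //=; rewrite -wi -ba.
    right; exists k; first by exists x; rewrite -bg.
    by exists x => //=; rewrite -wg -bg.
  by case: bQ => [[a Qa <-]|[k _ [x Qx <-]]] /=; rewrite ?wi ?wg.
apply: closedI; last exact: gauge_closed_sublevel gB.1.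
apply: closedU; first exact: i_closed (closed_preimage v_ext.1 clQ).
apply: closed_bigcup => [|k _]; first exact: g_proper.
have ck : continuous (fun x : disc R n => (k, x)).
  by apply: continuous_pair (@cst_continuous _ _ k) _ => x; exact: cvg_id.
apply: weakly_hausdorff_compact_image (comp_continuous ck cg).
- exact: hB.2.
- exact: hausdorff_disc.
- apply: (subclosed_compact _ (@disc_compact R n)) => //.
  apply: (closed_preimage (f := fun x => u (k, x))) clQ.
  by apply: (comp_continuous ck); case: u_ext.
Qed.

(** Near infinity in [B] there is nothing but points near infinity in [A] and
    points of all but finitely many discs; the finitely many others are compact,
    so they lie below some value of the gauge. *)
Lemma glue_exterior : exterior_map (X := cocompact hB) w.
Proof.
split; first exact: glue_continuous.
move=> F eF; apply/(gauge_exteriorP _ gB); split.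
  exact: open_preimage glue_continuous (exterior_open eF).
have /(gauge_exteriorP _ gA) [_ [t1 vF]] := v_ext.2 _ eF.
have /(bar_nat_exteriorP _ _ (@disc_compact R n)) [_ fS] := u_ext.2 _ eF.
set S := [set k | _] in fS.
have cS : compact (S `*` [set: disc R n]).
  by apply: compact_setX; [exact: finite_compact|exact: disc_compact].
have [t2 gt2] := compact_ubound (comp_continuous cg gB.1) cS.
exists (Num.max t1 t2) => b; rewrite gt_max => /andP[t1b t2b].
have [[a ba]|[[k x] bg]] := w_cover b.
  by rewrite /= ba wi; apply: vF; rewrite /= -ba.
rewrite /= bg wg; apply: contrapT => nF.
have /gt2 /= : (S `*` [set: disc R n]) (k, x) by split => //; exists x.
by rewrite -bg leNgt t2b.
Qed.

End Glue.

(** Recognition principle: if [B] is covered without overlap by the closed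
    subspace [A] and by open discs along which the gauge tends to infinity, then
    [B] is the pushout of exterior spaces.  Mapping out of [B] is then gluing
    over a closed cover that is finite below each value of the gauge. *)
Lemma cell_pushout :
  is_pushout (K := E) (C := cocompact hA) (D := cocompact hB) (gen_cof R n) f g i.
Proof.
split.
  split=> //; first exact: gen_cof_exterior.
  exact: (gauge_exterior_map hA hB gA gB ci).
split; first by apply/funext => -[k x]; exact: gf.
move=> T u v u_ext v_ext uv.
have uvE k x : u (k, set_val x) = v (f (k, x)) := congr1 (@^~ (k, x)) uv.
pose spec b t := (exists a, b = i a /\ t = v a) \/
  (exists k x, [/\ ~ sphere R n x, b = g (k, x) & t = u (k, x)]).
have /boolp.choice [w wP] : forall b, exists t, spec b t.
  move=> b; have [[a ba]|[k [x [nx bg]]]] := ig_surj b.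
    by exists (v a); left; exists a.
  by exists (u (k, x)); right; exists k, x.
have wi a : w (i a) = v a.
  by have [[a' [/i_inj -> //]]|[k [x [nx /esym /ig_disj]]]] := wP (i a).
have wg p : w (g p) = u p.
  case: p => k x; have [Sx|nSx] := pselect (sphere R n x).
    have -> : x = set_val (exist _ x (mem_set Sx) : sphere R n) by [].
    by rewrite gf wi uvE.
  have [[a [/ig_disj]] //|[k' [x' [nx' + ->]]]] := wP (g (k, x)).
  by move/g_inj => -> .
exists w; split.
  split; [exact: glue_exterior u_ext v_ext wi wg|exact/funext|exact/funext].
move=> w' [_ w'g w'i]; apply/funext => b.
have [[a ->]|[k [x [_ ->]]]] := ig_surj b.
  by rewrite wi -w'i.
by rewrite wg -w'g.
Qed.

End Pushout.

End Gauge.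

(** * The cells of a relative cell complex *)

Definition indiscrete (T : Type) : topologicalType :=
  initial_topology (fun _ : {classic T} => 0%N).

Lemma indiscrete_continuous (S : topologicalType) (T : Type)
  (f : S -> indiscrete T) : continuous f.
Proof.
apply: continuous_comp_initial => x; exact: (@cst_continuous _ _ 0%N).
Qed.

Section Complex.
Variables (R : realType) (A X : topologicalType) (i : A -> X).
Variable C : relCellComplex R i.

Definition cell_map n (c : cell C n) (x : disc R n) : X :=
  skel_in (charac (existT _ c x)).

Definition prev_in n : prev_skel A (skel C) n -> X :=
  match n with 0%N => i | m.+1 => @skel_in _ _ _ _ C m end.

Lemma skel_in_map n (p : prev_skel A (skel C) n) :
  skel_in (skel_map p) = prev_in p.
Proof.
case: n p => [|n] p /=; first by rewrite -[in RHS](skel_in0 C).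
exact: (congr1 (@^~ p) (skel_inS C n)).
Qed.

Lemma charac_attach n (c : cell C n) (y : sphere R n) :
  charac (existT _ c (set_val y)) = skel_map (attach (existT _ c y)).
Proof.
have [_ [e _]] := skel_pushout C n.
exact: (congr1 (@^~ (existT _ c y)) e).
Qed.

Lemma cell_map_continuous n (c : cell C n) : continuous (cell_map c).
Proof.
apply: comp_continuous; last exact: skel_in_cont.
have [[_ _ cch _] _] := skel_pushout C n.
exact: comp_continuous (@existT_continuous _ (fun=> disc R n) c) cch.
Qed.

(** The universal properties of the skeleta reduce the construction of a map on
    [X] to extending maps from one sphere to its disc; [Q] records what the
    extensions are required to satisfy on each closed cell. *)
Lemma extend_cellwise (T : topologicalType) (u0 : A -> T)
    (Q : forall n, cell C n -> (disc R n -> T) -> Prop) :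
  continuous u0 ->
  (forall n (c : cell C n) (b : sphere R n -> T), continuous b ->
    exists F : disc R n -> T, [/\ continuous F, F \o set_val = b & Q n c F]) ->
  exists w : X -> T,
    [/\ continuous w, w \o i = u0 & forall n (c : cell C n), Q n c (w \o cell_map c)].
Proof.
move=> cu0 ext.
pose spec n (v : {v : prev_skel A (skel C) n -> T | continuous v})
    (w : {w : skel C n -> T | continuous w}) :=
  sval w \o @skel_map _ _ _ _ C n = sval v /\
  forall c : cell C n, Q n c (fun x => sval w (charac (existT _ c x))).
have step n : {F & forall v, spec n v (F v)}.
  apply: (boolp.choice (P := spec n)) => -[v cv].
  have [[cbd cat cch csk] [_ univ]] := skel_pushout C n.
  have extc (c : cell C n) : exists F : disc R n -> T, [/\ continuous F,
      F \o set_val = (fun y => v (attach (existT _ c y))) & Q n c F].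
    apply: ext.
    have cac := comp_continuous (@existT_continuous _ (fun=> sphere R n) c) cat.
    exact: comp_continuous cac cv.
  have [F FP] := boolp.choice extc.
  pose sumF (z : {c : cell C n & disc R n}) : T := F (projT1 z) (projT2 z).
  have csumF : continuous sumF.
    by apply: (@sigT_continuous _ _ _ F) => c; have [] := FP c.
  have [|w [[cw wch wsk] _]] := univ T sumF v csumF cv.
    apply/funext => -[c y]; have [_ e _] := FP c.
    exact: (congr1 (@^~ y) e).
  exists (exist _ w cw); split=> //= c.
  have -> : (fun x => w (charac (existT _ c x))) = F c.
    by apply/funext => x; rewrite -[LHS]/((w \o @charac _ _ _ _ C n) _) wch.
  by have [] := FP c.
pose us := fix us n : {v : prev_skel A (skel C) n -> T | continuous v} :=
  match n with
  | 0%N => exist _ u0 cu0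
  | m.+1 => projT1 (step m) (us m)
  end.
have usP n : spec n (us n) (us n.+1) := projT2 (step n) (us n).
have [||w [[cw wsk] _]] := skel_colimit (r := C) (u := fun n => sval (us n.+1)).
- by move=> n; exact: (svalP (us n.+1)).
- by move=> n; exact: (usP n.+1).1.
exists w; split=> // [|n c].
  rewrite -(skel_in0 C) compA wsk; exact: (usP 0%N).1.
have -> : w \o cell_map c = fun x => sval (us n.+1) (charac (existT _ c x)).
  by rewrite -wsk.
exact: (usP n).2.
Qed.

(** Every function to an indiscrete space is continuous, so the uniqueness part
    of the universal property says that two predicates on the pushout that agree
    on both pieces are equal. *)
Lemma skel_cover n (z : skel C n) :
  (exists p, z = skel_map p) \/ exists (c : cell C n) x, z = charac (existT _ c x).
Proof.
pose w1 : skel C n -> indiscrete Prop := fun z =>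
  (exists p, z = skel_map p) \/ exists (c : cell C n) x, z = charac (existT _ c x).
pose w2 : skel C n -> indiscrete Prop := fun=> True.
have [_ [_ univ]] := skel_pushout C n.
have [|||w [_ wu]] := univ (indiscrete Prop) (fun=> True) (fun=> True).
- exact: indiscrete_continuous.
- exact: indiscrete_continuous.
- by [].
suff e : w1 = w2 by change (w1 z); rewrite e.
transitivity w; [apply/esym/wu|apply: wu].
  split; first exact: indiscrete_continuous.
    by apply/funext => -[c x]; rewrite propeqE; split=> // _; right; exists c, x.
  by apply/funext => p; rewrite propeqE; split=> // _; left; exists p.
by split => //; exact: indiscrete_continuous.
Qed.

Lemma complex_cover x : exists n (z : skel C n), x = skel_in z.
Proof.
pose w1 : X -> indiscrete Prop := fun x => exists n (z : skel C n), x = skel_in z.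
pose w2 : X -> indiscrete Prop := fun=> True.
have [||w [_ wu]] := skel_colimit (r := C) (u := fun n _ => True : indiscrete Prop).
- by move=> n; exact: indiscrete_continuous.
- by [].
suff e : w1 = w2 by change (w1 x); rewrite e.
transitivity w; [apply/esym/wu|apply: wu].
  split; first exact: indiscrete_continuous.
  by move=> n; apply/funext => z; rewrite propeqE; split=> // _; exists n, z.
by split => //; exact: indiscrete_continuous.
Qed.

Lemma prev_in_cover n (p : prev_skel A (skel C) n) :
  (exists a, prev_in p = i a) \/
  exists m (c : cell C m) y,
    [/\ (m < n)%N, ~ sphere R m y & prev_in p = cell_map c y].
Proof.
elim: n p => [|n IHn] p; first by left; exists p.
have fromIH (q : prev_skel A (skel C) n) : p = skel_map q ->
  (exists a, prev_in (n := n.+1) p = i a) \/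
  exists m (c : cell C m) y,
    [/\ (m < n.+1)%N, ~ sphere R m y & prev_in (n := n.+1) p = cell_map c y].
  move=> -> /=; rewrite skel_in_map.
  have [[a ->]|[m [c [y [mn Sy ->]]]]] := IHn q; first by left; exists a.
  by right; exists m, c, y; split => //; exact: ltnW.
have [[q /fromIH //]|[c [y pE]]] := skel_cover p.
have [Sy|nSy] := pselect (sphere R n y); last by right; exists n, c, y; rewrite pE.
apply: (fromIH (attach (existT _ c (exist _ y (mem_set Sy) : sphere R n)))).
by rewrite -charac_attach.
Qed.

Lemma point_cover x :
  (exists a, x = i a) \/
  exists n (c : cell C n) y, ~ sphere R n y /\ x = cell_map c y.
Proof.
have [n [z ->]] := complex_cover x.
have [[a e]|[m [c [y [_ Sy e]]]]] := prev_in_cover (n := n.+1) z.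
  by left; exists a.
by right; exists m, c, y.
Qed.

Lemma boundary_cover n (c : cell C n) (y : sphere R n) :
  (exists a, cell_map c (set_val y) = i a) \/
  exists m (c' : cell C m) y',
    [/\ (m < n)%N, ~ sphere R m y' & cell_map c (set_val y) = cell_map c' y'].
Proof.
rewrite /cell_map charac_attach skel_in_map; exact: prev_in_cover.
Qed.

(** The function that reads off the open cell containing a point, together with
    its coordinates there.  With values in an indiscrete space it is obtained
    from [extend_cellwise], and its mere existence shows that the open cells are
    injectively parametrised, disjoint from each other and from the base. *)
Lemma cell_coordinates :
  exists nf : X -> A + {n & (cell C n * disc R n)%type},
    (forall a, nf (i a) = inl a) /\
    forall n (c : cell C n) y, ~ sphere R n y ->
      nf (cell_map c y) = inr (existT _ n (c, y)).
Proof.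
pose N : Type := (A + {n & (cell C n * disc R n)%type})%type.
have [||w [_ wi wQ]] := @extend_cellwise (indiscrete N) (inl : A -> N)
  (fun n c F => forall y, ~ sphere R n y -> F y = inr (existT _ n (c, y))).
- exact: indiscrete_continuous.
- move=> n c b _.
  exists (fun y => if pselect (sphere R n y) is left Sy
    then b (exist _ y (mem_set Sy)) else inr (existT _ n (c, y))).
  split; first exact: indiscrete_continuous.
    apply/funext => y /=; case: pselect => [Sy|nSy].
      by congr b; exact: set_type_inj.
    by exfalso; apply/nSy/set_valP.
  by move=> y nSy; case: pselect.
exists w; split=> [a|n c y]; last exact: wQ.
exact: (congr1 (@^~ a) wi).
Qed.

Lemma open_cell_disjoint_base n (c : cell C n) y a :
  ~ sphere R n y -> cell_map c y <> i a.
Proof.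
have [nf [nfi nfc]] := cell_coordinates.
by move=> Sy e; have := congr1 nf e; rewrite nfi nfc.
Qed.

Lemma open_cell_inj n (c : cell C n) y n' (c' : cell C n') y' :
  ~ sphere R n y -> ~ sphere R n' y' -> cell_map c y = cell_map c' y' ->
  existT (fun n => cell C n * disc R n)%type n (c, y) = existT _ n' (c', y').
Proof.
have [nf [_ nfc]] := cell_coordinates.
move=> Sy Sy' /(congr1 nf); rewrite !nfc // => e.
exact: Some_inj (congr1 (fun z => if z is inr d then Some d else None) e).
Qed.

End Complex.

(** * A proper retraction onto the half-line *)

Section Proper.
Variable R : realType.

Lemma sphere_closed n : closed (sphere R n).
Proof.
apply: (closed_preimage (f := @sqnorm R n \o set_val) (A := [set y | y = 1])).
  by apply: comp_continuous; [exact: set_val_continuous|exact: sqnorm_continuous].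
exact: closed_eq.
Qed.

Lemma gauge_Rplus : gauge (set_val : Rplus R -> R).
Proof.
split=> [|t]; first exact: set_val_continuous.
have -> : [set y : Rplus R | set_val y <= t] = set_val @^-1` `[0, t]%classic.
  apply/seteqP; split=> y /=; rewrite in_itv /=; last by case/andP.
  by move=> ->; rewrite andbT; exact: (set_valP y).
by apply: compact_set_val; [exact: closed_ge|exact: segment_compact].
Qed.

(** The third condition is what makes the resulting retraction proper: [F] takes
    a small value only if it already does so on the boundary, or if [j],
    which will be the number of the cell, is small. *)
Lemma disc_extension n (b : sphere R n -> Rplus R) (j : R) :
  0 <= j -> continuous b ->
  exists F : disc R n -> Rplus R, [/\ continuous F, F \o set_val = b &
    forall x t, set_val (F x) <= t ->
      j <= t \/ exists y : sphere R n, set_val (F (set_val y)) <= t].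
Proof.
move=> j0 cb.
have [[y0 _]|noS] := pselect ([set: sphere R n] !=set0); last first.
  have noy (y : sphere R n) : False by apply: noS; exists y.
  exists (fun=> exist _ j (mem_set (j0 : Rplus R j))); split.
  - exact: cst_continuous.
  - by apply/funext => y; case: (noy y).
  - by move=> x t; left.
pose vb := set_val \o b : sphere R n -> R.
have cvb : continuous vb by apply: comp_continuous => //; exact: set_val_continuous.
have [y1 _ y1min] : exists2 c, c \in [set: sphere R n] &
    forall t, t \in [set: sphere R n] -> vb c <= vb t.
  apply: compact_EVT_min; first by exists y0.
    exact: sphere_compact.
  exact: continuous_subspaceT.
have {}y1min y : vb y1 <= vb y by apply: y1min; rewrite inE.
have [M0 M0P] := compact_ubound cvb (@sphere_compact R n).
(* Tietze's theorem asks for a positive bound. *)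
pose M := Num.max M0 1.
have f_ext y : valL_ 0 vb (set_val y) = vb y.
  exact: (congr1 (@^~ y) (valLK 0 vb)).
have f_bd x : sphere R n x -> `|valL_ 0 vb x| <= M.
  move=> Sx; have -> : x = set_val (exist _ x (mem_set Sx) : sphere R n) by [].
  rewrite f_ext ger0_norm; last exact: (set_valP (b _)).
  by apply: le_trans (M0P _ _) _ => //; rewrite le_max lexx.
have nD : normal_space (disc R n).
  by apply: compact_normal; [exact: hausdorff_disc|exact: disc_compact].
have M_gt0 : 0 < M by rewrite lt_max ltr01 orbT.
have [g [fg cg _]] := continuous_bounded_extension nD (@sphere_closed n) M_gt0
  ((subspace_valL_continuousP' _ 0 vb).2 cvb) f_bd.
have F0 x : 0 <= Num.max (g x) (vb y1).
  by rewrite le_max; apply/orP; right; exact: (set_valP (b y1)).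
have Fb y : Num.max (g (set_val y)) (vb y1) = vb y.
  by rewrite -fg ?f_ext; [exact/max_idPl|exact/mem_set/set_valP].
pose F x : Rplus R := exist _ (Num.max (g x) (vb y1)) (mem_set (F0 x)).
exists F; split.
- apply: set_type_continuous => x.
  apply: (continuous_max (f := g) (g := fun=> vb y1)); first exact: cg.
  exact: (@cst_continuous _ _ (vb y1)).
- by apply/funext => y; apply: set_type_inj; exact: Fb.
- move=> x t Fx; right; exists y1; apply: le_trans Fx.
  by rewrite !set_valE /= Fb le_max lexx orbT.
Qed.

Section ProperRetraction.
Variables (X : topologicalType) (s : Rplus R -> X).
Variable C : relCellComplex R s.
Hypotheses (fdC : finite_dimensional C) (lfC : locally_finite C).
Hypothesis (cntC : countably_many_cells C).

Lemma base_continuous : continuous s.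
Proof.
have cs0 : continuous (@skel_map _ _ _ _ C 0) by have [[]] := skel_pushout C 0.
by rewrite -(skel_in0 C); exact: comp_continuous cs0 (@skel_in_cont _ _ _ _ C 0).
Qed.

Lemma compact_cell n (c : cell C n) : compact (closed_cell c).
Proof.
apply: continuous_compact; last exact: disc_compact.
exact/continuous_subspaceT/cell_map_continuous.
Qed.

Lemma compact_finite_cells (K : set X) : compact K ->
  finite_set [set e : {n & cell C n} | K `&` closed_cell (projT2 e) !=set0].
Proof.
move=> cK; apply: (compact_locally_finite cK) => x _.
by have [U nU fU] := lfC x; exists U.
Qed.

Lemma compact_bigcup (I : choiceType) (S : set I) (A : I -> set X) :
  finite_set S -> (forall e, compact (A e)) -> compact (\bigcup_(e in S) A e).
Proof.
move=> fS cA; rewrite -bigsetU_fset_set //.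
by apply: bigsetU_compact => e _.
Qed.

Section FiniteSublevels.
Variables (rho : X -> Rplus R) (enc : forall n, cell C n -> nat).
Let h := set_val \o rho.
Hypotheses (crho : continuous rho) (rhos : rho \o s = id).
Hypothesis enc_inj : forall n, injective (@enc n).
Hypothesis rho_min : forall n (c : cell C n) x t, h (cell_map c x) <= t ->
  (enc c)%:R <= t \/ exists y : sphere R n, h (cell_map c (set_val y)) <= t.

(** Induction on the dimension: a cell of dimension [N] meeting the sublevel set
    either has a small index or has a boundary point in the part [K] of the
    sublevel set that lies in lower cells; [K] is compact, so it meets finitely
    many cells. *)
Lemma sublevel_finite_cells t N : finite_set [set e : {n & cell C n} |
  (projT1 e < N)%N /\ exists x, h (cell_map (projT2 e) x) <= t].
Proof.
elim: N => [|N IHN]; first by apply: sub_finite_set (finite_set0 _) => e [].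
set S := [set e | _] in IHN.
pose K := s @` [set u | set_val u <= t] `|`
  \bigcup_(e in S) closed_cell (projT2 e).
have cK : compact K.
  apply: compactU; last by apply: compact_bigcup => // e; exact: compact_cell.
  apply: continuous_compact; last exact: gauge_Rplus.2.
  exact/continuous_subspaceT/base_continuous.
have fE : finite_set [set c : cell C N | (enc c)%:R <= t :> R].
  apply: (sub_finite_set (B := @enc N @^-1` `I_(Num.bound `|t|))).
    move=> c /= ct; rewrite -(ltr_nat R); apply: le_lt_trans ct _.
    by apply: le_lt_trans (ler_norm t) _; exact: archi_boundP (normr_ge0 t).
  apply: finite_preimage; last exact: finite_II.
  by move=> c c' _ _; exact: enc_inj.
set E := [set c | _] in fE.
have fU : finite_set (S `|` ([set existT _ N c | c in E] `|`
    [set e : {n & cell C n} | K `&` closed_cell (projT2 e) !=set0])).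
  rewrite !finite_setU; split=> //; split; first exact: finite_image.
  exact: compact_finite_cells.
apply: sub_finite_set fU.
move=> [n c] /= [nN [x hx]]; rewrite ltnS leq_eqVlt in nN.
case/orP: nN => [/eqP nN|nN]; last by left; split=> //; exists x.
right; subst n; have [ct|[y hy]] := rho_min hx; first by left; exists c.
right; exists (cell_map c (set_val y)); split; last by exists (set_val y).
have [[u e]|[m [c' [y' [mN _ e]]]]] := boundary_cover c y.
  left; exists u => //; move: hy; rewrite e /h /=.
  by rewrite -[rho (s u)]/((rho \o s) u) rhos.
right; exists (existT _ m c'); last by exists y' => //; exact: esym e.
by split=> //; exists y'; rewrite -e.
Qed.

Lemma gauge_retraction : gauge h.
Proof.
have ch : continuous h by apply: comp_continuous => //; exact: set_val_continuous.
split=> // t; have [d dP] := fdC.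
pose S := [set e : {n & cell C n} |
  (projT1 e < d.+1)%N /\ exists x, h (cell_map (projT2 e) x) <= t].
pose K := s @` [set u | set_val u <= t] `|`
  \bigcup_(e in S) closed_cell (projT2 e).
have cK : compact K.
  apply: compactU; last first.
    apply: compact_bigcup => [|e]; last exact: compact_cell.
    exact: sublevel_finite_cells.
  apply: continuous_compact; last exact: gauge_Rplus.2.
  exact/continuous_subspaceT/base_continuous.
apply: (subclosed_compact _ cK); first exact: gauge_closed_sublevel.
move=> x /= hx; have [[u e]|[n [c [y [_ e]]]]] := point_cover C x.
  left; exists u; rewrite ?e //=; move: hx; rewrite e /h /=.
  by rewrite -[rho (s u)]/((rho \o s) u) rhos.
right; exists (existT _ n c); last by exists y => //; exact: esym e.
split; last by exists y; rewrite /= -e.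
by rewrite /= ltnS leqNgt; apply/negP => /dP /(_ c).
Qed.

End FiniteSublevels.

Lemma proper_retraction :
  exists2 rho : X -> Rplus R, rho \o s = id & gauge (set_val \o rho).
Proof.
have encP n : exists f : cell C n -> nat, injective f.
  have /countable_injP [f f_inj] := cntC n.
  by exists f => c c'; apply: f_inj; rewrite inE.
pose enc n := projT1 (cid (encP n)).
have enc_inj n : injective (enc n) := projT2 (cid (encP n)).
have [|n c b cb|rho [crho rhos rhoQ]] := @extend_cellwise R _ X s C (Rplus R) id
  (fun n c F => forall x t, set_val (F x) <= t ->
     (enc n c)%:R <= t \/ exists y : sphere R n, set_val (F (set_val y)) <= t).
- by move=> u; exact: cvg_id.
- exact: disc_extension.
by exists rho => //; apply: gauge_retraction enc_inj _.
Qed.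

End ProperRetraction.
End Proper.

(** * Ranks *)

Section Rank.
Variable P : pred nat.

(** The number of elements of [P] below [n]: the position of [n] among the
    elements of [P], used to skip the dimensions in which there are no cells. *)
Definition rank n : nat := \sum_(k < n) P k.

Lemma rankS n : rank n.+1 = (rank n + P n)%N.
Proof. by rewrite /rank big_ord_recr. Qed.

Lemma rank_lt m n : (m < n)%N -> P m -> (rank m < rank n)%N.
Proof.
move=> + Pm; elim: n => // n IHn; rewrite ltnS leq_eqVlt rankS.
by case/orP=> [/eqP <-|/IHn /leq_trans]; [rewrite Pm addn1|apply; exact: leq_addr].
Qed.

Lemma rank_surj a n : (a < rank n)%N -> exists2 m, P m & rank m = a.
Proof.
elim: n => [|n IHn]; first by rewrite /rank big_ord0.
rewrite rankS; have [//|le_na] := ltnP a (rank n); first by move=> /IHn.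
case Pn: (P n); last by rewrite addn0 ltnNge le_na.
by rewrite addn1 ltnS => le_an; exists n => //; apply/eqP; rewrite eqn_leq le_na.
Qed.

Lemma rank_inj m n : P m -> P n -> rank m = rank n -> m = n.
Proof.
move=> Pm Pn e; case: (ltngtP m n) => // /rank_lt.
  by move=> /(_ Pm); rewrite e ltnn.
by move=> /(_ Pn); rewrite e ltnn.
Qed.

End Rank.

Lemma countable_prod_nat_bij (T : Type) (t0 : T) :
  countable [set: T] -> exists phi : nat -> T * nat, bijective phi.
Proof.
move=> cT.
have /card_set_bijP [f] : ([set: T * nat] #= [set: nat])%card.
  apply: eq_card_nat; first by rewrite -setXTT; apply: countableX.
  move=> fin; apply: infinite_nat.
  apply: (sub_finite_set (B := snd @` [set: T * nat])); last exact: finite_image.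
  by move=> n _; exists (t0, n).
by rewrite setTT_bijective => -[g fK gK]; exists g; exists f.
Qed.

(** * The thickened complex and its filtration *)

Section Cofibrant.
Variables (R : realType) (X : topologicalType) (hX : cgwh X) (s : Rplus R -> X).
Variable C : relCellComplex R s.
Hypotheses (lfC : locally_finite C) (cntC : countably_many_cells C).
Variable rho : X -> Rplus R.
Hypothesis rhos : rho \o s = id.
Let h := set_val \o rho.
Hypothesis gh : gauge h.

Let h0 x : 0 <= h x. Proof. exact: (set_valP (rho x)). Qed.
Let hs u : h (s u) = set_val u.
Proof. by rewrite /h /= -[rho (s u)]/((rho \o s) u) rhos. Qed.

Let inhab : pred nat := fun n => `[< exists c : cell C n, True >].
Let inhabP n (c : cell C n) : inhab n. Proof. by apply/asboolP; exists c. Qed.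
Let rk := rank inhab.

(** The filtration by skeleta, indexed by rank rather than by dimension so that
    each step adds cells of exactly one dimension. *)
Definition layer a : set X := [set x | (exists u, x = s u) \/
  exists n (c : cell C n) y, [/\ (rk n < a)%N, ~ sphere R n y & x = cell_map c y]].

Lemma layer_sub a b : (a <= b)%N -> layer a `<=` layer b.
Proof.
move=> ab x [[u ->]|[n [c [y [na Sy ->]]]]]; first by left; exists u.
by right; exists n, c, y; split=> //; exact: leq_trans na ab.
Qed.

Lemma boundary_layer n (c : cell C n) (y : sphere R n) :
  layer (rk n) (cell_map c (set_val y)).
Proof.
have [[u ->]|[m [c' [y' [mn Sy' ->]]]]] := boundary_cover c y.
  by left; exists u.
right; exists m, c', y'; split=> //; exact: rank_lt mn (inhabP c').
Qed.

Lemma closed_cell_layer n (c : cell C n) a x :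
  (rk n < a)%N -> layer a (cell_map c x).
Proof.
move=> na; have [Sx|nSx] := pselect (sphere R n x).
  apply: (layer_sub (ltnW na)).
  exact: (boundary_layer c (exist _ x (mem_set Sx) : sphere R n)).
by right; exists n, c, x.
Qed.

(** Below each value of the gauge, a layer is a finite union of closed cells and
    a compact piece of the base. *)
Lemma layer_closed a : closed (layer a).
Proof.
apply: (gauge_closed gh.1) => t.
pose S := [set e : {n & cell C n} | (rk (projT1 e) < a)%N] `&`
  [set e | [set x | h x <= t] `&` closed_cell (projT2 e) !=set0].
have -> : layer a `&` [set y | h y <= t] = (s @` [set u | set_val u <= t] `|`
    \bigcup_(e in S) closed_cell (projT2 e)) `&` [set y | h y <= t].
  apply/seteqP; split=> x [] /=; last first.
    case=> [[u _ <-] ?|[[n c] /= [na _] [y _ <-]] ?]; split=> //.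
      by left; exists u.
    exact: closed_cell_layer.
  move=> + ht; case=> [[u xu]|[n [c [y [na Sy xy]]]]]; split=> //.
    by left; exists u => //=; rewrite -hs -xu.
  right; exists (existT _ n c); last by exists y => //; exact: esym xy.
  by split=> //; exists x; split=> //; exists y => //; exact: esym xy.
apply: closedI; last exact: gauge_closed_sublevel gh.1.
apply: closedU.
  apply: weakly_hausdorff_compact_image; first exact: hX.2.
  - exact/hausdorff_set_type/Rhausdorff.
  - exact: (gauge_Rplus R).2.
  - exact: base_continuous C.
apply: closed_bigcup => [|[n c] _].
  by apply: finite_setIr; apply: compact_finite_cells lfC _ (gh.2 t).
exact: (weakly_hausdorff_compact_image hX.2 (@hausdorff_disc R n)
  (@disc_compact R n) (@cell_map_continuous _ _ _ _ _ n c)).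
Qed.

Let H (p : X * nat) : R := h p.1 + p.2%:R.
Let gH : gauge H. Proof. exact: gauge_prod_nat. Qed.

Definition thick a : set (X * nat) := [set p | layer a p.1].

Lemma thick_closed a : closed (thick a).
Proof.
apply: (closed_preimage (f := fst) (A := layer a)); last exact: layer_closed.
by move=> [x j]; exact: cvg_fst.
Qed.

Let hZ a : cgwh (thick a) :=
  cgwh_closed_subset (cgwh_prod_nat hX) (@thick_closed a).

Definition thickE a : extSpace := cocompact (hZ a).

Let k a : thick a -> R := H \o set_val.
Let gk a : gauge (@k a). Proof. exact: gauge_set_val (@thick_closed a) gH. Qed.

Definition thick_point a x j (xa : layer a x) : thick a :=
  exist _ (x, j) (mem_set (xa : thick a (x, j))).

Definition thick_incl a b (ab : (a <= b)%N) (z : thick a) : thick b :=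
  exist _ (set_val z) (mem_set (layer_sub ab (set_valP z) : thick b (set_val z))).

Lemma thick_incl_continuous a b (ab : (a <= b)%N) : continuous (thick_incl ab).
Proof. by apply: set_type_continuous; exact: set_val_continuous. Qed.

Lemma thick_incl_ext a b (ab : (a <= b)%N) :
  exterior_map (X := thickE a) (Y := thickE b) (thick_incl ab).
Proof. by apply: gauge_exterior_map (gk a) (gk b) (@thick_incl_continuous _ _ ab) _. Qed.

Lemma thick_incl_closed a b (ab : (a <= b)%N) (P : set (thick a)) :
  closed P -> closed (thick_incl ab @` P).
Proof.
move=> clP; have -> : thick_incl ab @` P = set_val @^-1` (set_val @` P).
  apply/seteqP; split=> [_ [z Pz <-]|z [z' Pz' e]]; first by exists z.
  by exists z' => //; apply: set_type_inj.
apply: closed_preimage; first exact: set_val_continuous.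
by apply: closed_set_val => //; exact: thick_closed.
Qed.

(** Passing from one layer to the next adds the cells of a single dimension [n];
    times [nat], these are countably infinitely many, and a bijection of [nat]
    with the pairs of an [n]-cell and a natural number presents them as one
    pushout of the generating cofibration. *)
Lemma thick_pushout a b n (ab : (a <= b)%N) (c0 : cell C n) :
  b = a.+1 -> rk n = a ->
  exists (f : Nsphere R n -> thickE a) (g : Ndisc R n -> thickE b),
    is_pushout (K := E) (gen_cof R n) f g (thick_incl ab).
Proof.
move=> bE aE; subst b.
have [phi [psi phiK psiK]] := countable_prod_nat_bij c0 (cntC n).
have fP m (y : sphere R n) : layer a (cell_map (phi m).1 (set_val y)).
  by rewrite -aE; exact: boundary_layer.
have gP m (x : disc R n) : layer a.+1 (cell_map (phi m).1 x).
  by apply: closed_cell_layer; rewrite aE.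
pose f p : thick a := thick_point (phi p.1).2 (fP p.1 p.2).
pose g p : thick a.+1 := thick_point (phi p.1).2 (gP p.1 p.2).
exists f, g; apply: cell_pushout (gk a.+1) _ _ _ _ _ _ _ _ _ _ _.
- exact: gk.
- exact: thick_incl_continuous.
- by move=> z z' /(congr1 set_val) e; apply: set_type_inj.
- exact: thick_incl_closed.
- apply: continuous_nat_prod => m; apply: set_type_continuous.
  apply: (continuous_pair (f := cell_map (phi m).1 \o set_val)
    _ (@cst_continuous _ _ (phi m).2)).
  by apply: comp_continuous; [exact: set_val_continuous|exact: cell_map_continuous].
- apply: continuous_nat_prod => m; apply: set_type_continuous.
  apply: (continuous_pair (f := cell_map (phi m).1)
    _ (@cst_continuous _ _ (phi m).2)).
  exact: cell_map_continuous.
- by move=> m y; apply: set_type_inj.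
- move=> t.
  have fin : finite_set ([set c : cell C n | exists x, h (cell_map c x) <= t] `*`
      `I_(Num.bound `|t|)).
    apply: finite_setX; last exact: finite_II.
    have fC := compact_finite_cells lfC (gh.2 t).
    apply: sub_finite_set (finite_preimage (f := existT (fun n => cell C n) n) _ fC).
      by move=> c [x hx]; exists (cell_map c x); split => //; exists x.
    move=> c c' _ _; exact: existT_inj2.
  apply: sub_finite_set (finite_preimage (f := phi) _ fin).
    move=> m [x]; rewrite /k /H /= => Hm; split=> /=.
      by exists x; apply: le_trans Hm; rewrite lerDl.
    rewrite -(ltr_nat R); apply: le_lt_trans (archi_boundP (normr_ge0 t)).
    by apply: le_trans (ler_norm t); apply: le_trans Hm; rewrite lerDr.
  by move=> m m' _ _; exact: (can_inj phiK).
- move=> [[x j] zP]; move: (set_mem zP); rewrite /thick /= => -[[u xu]|].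
    have xa : layer a x by left; exists u.
    by left; exists (thick_point j xa); apply: set_type_inj.
  move=> [m [c [y [ma Sy xy]]]]; rewrite ltnS leq_eqVlt in ma.
  case/orP: ma => [/eqP ma|ma]; last first.
    have xa : layer a x by right; exists m, c, y.
    by left; exists (thick_point j xa); apply: set_type_inj.
  have mn : m = n by apply: rank_inj (inhabP c) (inhabP c0) _; rewrite -/rk ma.
  subst m; right; exists (psi (c, j)), y; split=> //.
  apply: set_type_inj.
  rewrite -[RHS]/(cell_map (phi (psi (c, j))).1 y, (phi (psi (c, j))).2).
  by rewrite psiK /= -xy.
- move=> m y z Sy /(congr1 (fst \o set_val)) /= e.
  have [[u zu]|[m' [c [y' [ma Sy' zy]]]]] := set_valP z.
    exact: (open_cell_disjoint_base Sy (etrans e zu)).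
  have := open_cell_inj Sy Sy' (etrans e zy).
  by move=> /(congr1 (@projT1 _ _)) /= nm; rewrite -nm aE ltnn in ma.
- move=> m y m' y' Sy Sy' /(congr1 set_val) /= [e1 e2].
  have [ec ->] := existT_inj2 (open_cell_inj Sy Sy' e1).
  congr pair; apply: (can_inj phiK).
  by rewrite (surjective_pairing (phi m)) ec e2 -surjective_pairing.
Qed.

Let shift_ge0 p : Rplus R (H p).
Proof. exact: addr_ge0 (h0 p.1) (ler0n _ _). Qed.

Definition shift (p : X * nat) : Rplus R := exist _ (H p) (mem_set (shift_ge0 p)).

Lemma shift_continuous : continuous shift.
Proof. by apply: set_type_continuous; exact: gH.1. Qed.

(** Retracts [X * nat] onto its copy of index [0].  The other copies are sent
    into the base, at the point whose gauge is that of the argument, which keeps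
    the map proper. *)
Definition fold (p : X * nat) : X := if p.2 is 0%N then p.1 else s (shift p).

Lemma fold_continuous : continuous fold.
Proof.
apply: continuous_prod_nat => -[|j]; first by move=> x; exact: cvg_id.
have cj : continuous (fun x : X => (x, j.+1)).
  by apply: continuous_pair (@cst_continuous _ _ j.+1) => x; exact: cvg_id.
exact: comp_continuous (comp_continuous cj shift_continuous) (base_continuous C).
Qed.

Lemma fold_gauge p : h (fold p) = H p.
Proof. by case: p => x [|j]; rewrite /fold /= ?hs // /H addr0. Qed.

Lemma base_fold p u : p.1 = s u -> s (shift p) = fold p.
Proof.
case: p => x [|j] //= ->; congr s; apply: set_type_inj.
by rewrite -[LHS]/(h (s u) + 0) addr0 hs.
Qed.

Lemma base_retract_thick_incl a b (ab : (a <= b)%N) :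
  a = 0%N -> (forall x, layer b x) ->
  is_retract (K := E) (A := ERplus R) (B := cocompact hX) (C := thickE a)
    (D := thickE b) s (thick_incl ab).
Proof.
move=> a0 bT; subst a.
have s0 u : layer 0 (s u) by left; exists u.
exists (fun u => thick_point 0 (s0 u)), (shift \o set_val).
exists (fun x => thick_point 0 (bT x)), (fold \o set_val).
have c0 : continuous (fun x : X => (x, 0%N)).
  by apply: continuous_pair (@cst_continuous _ _ 0%N) => x; exact: cvg_id.
split; split.
- apply: gauge_exterior_map (gauge_Rplus R) (gk 0) _ _.
    by apply: set_type_continuous; exact: comp_continuous (base_continuous C) c0.
  by move=> u; rewrite /k /H /= addr0 hs.
- apply: gauge_exterior_map (gk 0) (gauge_Rplus R) _ _ => //.
  exact: comp_continuous (@set_val_continuous _ _) shift_continuous.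
- apply: gauge_exterior_map gh (gk b) _ _; first exact: set_type_continuous.
  by move=> x; rewrite /k /H /= addr0.
- apply: gauge_exterior_map (gk b) gh _ _.
    exact: comp_continuous (@set_val_continuous _ _) fold_continuous.
  by move=> z; rewrite /= fold_gauge.
- apply/funext => u; apply: set_type_inj.
  by rewrite -[LHS]/(h (s u) + 0) addr0 hs.
- by [].
- by apply/funext => u; apply: set_type_inj.
- apply/funext => z.
  have [[u zu]|[n [c [y []]]]] := set_valP z; last by rewrite ltn0.
  exact: base_fold zu.
Qed.

(** * The cell sequence *)

(* Joins the total order of ['I_n.+1] with its bottom and top elements, as the
   index type of a cell sequence requires. *)
HB.instance Definition _ n := Order.Total.on 'I_n.+1.

Lemma ord_lt_wf n : well_founded (fun a b : 'I_n.+1 => (a < b)%O).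
Proof.
move=> a; have [m] := ubnP (nat_of_ord a).
elim: m a => [a|m IHm a am]; first by rewrite ltn0.
constructor=> b ba; apply: IHm.
by have {}ba : (b < a)%N := ba; apply: leq_trans ba am.
Qed.

Section Sequence.
Variable d : nat.
Let l := rk d.

Definition thick_sequence : cellSequence R 'I_l.+1.
Proof.
refine (@CellSequence R _ 'I_l.+1 _ (fun a => thickE a)
  (fun a b (ab : (a <= b)%O) => @thick_incl a b ab) _ _ _ _ _).
- exact: ord_lt_wf.
- by move=> a b ab; exact: thick_incl_ext.
- by move=> a aa; apply/funext => z; apply: set_type_inj.
- by move=> a b c ab bc ac; apply/funext => z; apply: set_type_inj.
- move=> a b ab nab.
  have bE : b = a.+1 :> nat.
    apply/eqP; rewrite eqn_leq andbC; apply/andP; split; first exact: ab.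
    rewrite leqNgt; apply/negP => lt_ab.
    have lt_l : (a.+1 < l.+1)%N := ltn_trans lt_ab (ltn_ord b).
    have /negP := nab (Ordinal lt_l); apply; apply/andP; split; last exact: lt_ab.
    exact: ltnSn.
  have [|n /asboolP [c _] na] := @rank_surj inhab a d.
    by rewrite -ltnS -bE; exact: ltn_ord.
  by exists n; exact: thick_pushout c bE na.
(* There is no limit stage: a nonzero [b] is the successor of [b.-1]. *)
- move=> b b0 lim.
  have b_gt0 : (0 < b)%N by rewrite lt0n; apply: contra b0 => /eqP b0; apply/eqP/val_inj.
  have lt_l : (b.-1 < l.+1)%N by apply: leq_ltn_trans (leq_pred _) (ltn_ord b).
  have [|c /andP [b1c cb]] := lim (Ordinal lt_l).
    by rewrite -[(_ < _)%O]/(b.-1 < b)%N prednK.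
  have b1c' : (b.-1 < c)%N := b1c; have cb' : (c < b)%N := cb.
  by exfalso; move: (leq_ltn_trans b1c' cb'); rewrite prednK // ltnn.
Defined.

Lemma thick_sequence_retract : (forall x, layer l x) ->
  is_retract (K := E) (A := ERplus R) (B := cocompact hX)
    s (stage_map thick_sequence (lex1 (\bot%O : 'I_l.+1))).
Proof. by move=> lT; apply: base_retract_thick_incl. Qed.

End Sequence.

Lemma base_exterior : exterior_map (X := ERplus R) (Y := cocompact hX) s.
Proof.
exact: (gauge_exterior_map _ _ (gauge_Rplus R) gh (base_continuous C) hs).
Qed.

Lemma base_cofibration : finite_dimensional C ->
  cofibration R (A := ERplus R) (B := cocompact hX) s.
Proof.
move=> [d dP]; split; first exact: base_exterior.
exists _, 'I_(rk d.+1).+1, (thick_sequence d.+1).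
apply: thick_sequence_retract => x.
have [[u ->]|[n [c [y [Sy xy]]]]] := point_cover C x; first by left; exists u.
right; exists n, c, y; split=> //; apply: rank_lt (inhabP c).
by rewrite ltnS leqNgt; apply/negP => /dP /(_ c).
Qed.

Lemma retraction_exterior :
  exterior_map (X := cocompact hX) (Y := ERplus R) rho.
Proof.
exact: (gauge_exterior_map _ _ gh (gauge_Rplus R) (set_type_continuous gh.1)).
Qed.

End Cofibrant.

Theorem corollary4p5 (R : realType) (X : topologicalType) (hX : cgwh X)
    (s : Rplus R -> X) (C : relCellComplex R s) :
  connected [set: X] ->
  finite_dimensional C ->
  locally_finite C ->
  countably_many_cells C ->
  exists r : cocompact hX -> ERplus R, in_Cstar (X := cocompact hX) s r.
Proof.
move=> _ fdC lfC cntC.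
have [rho rhos gh] := proper_retraction fdC lfC cntC.
exists rho; split; last exact (base_cofibration hX lfC cntC rhos gh fdC).
split=> //; first exact (base_exterior hX C rhos gh).
exact (retraction_exterior hX gh).
Qed.
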